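(* For every fixed real $A>0$, we have, for all sufficiently large $n$ (depending on $A$), \[ F(n)-f(n,n)>\frac{A\,n\log n}{\log\log n}. \] Equivalently, \[ \frac{F(n)-f(n,n)}{n\log n/\log\log n}\longrightarrow\infty\qquad(n\to\infty). \]
   Context: $\mathbb{N}=\{1,2,3,\ldots\}$ and $\log$ is the natural logarithm. For $n,m\in\mathbb{N}$, $f(n,m)$ denotes the least nonnegative integer $h$ such that the interval $(m,m+h]$ contains pairwise distinct integers $a_1,\ldots,a_n$ with $i\mid a_i$ for all $1\le i\le n$. Such an $h$ always exists (indeed $f(n,m)\le n(n+1)/2$), and for fixed $n$ the function $m\mapsto f(n,m)$ is periodic modulo $\operatorname{lcm}(1,\ldots,n)$, so $F(n):=\max_{m\in\mathbb{N}}f(n,m)$ is finite and attained. *)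

(* Defs.v *)
From HB Require Import structures.
From mathcomp Require Import all_boot all_order all_algebra.
From mathcomp Require Import all_classical all_reals all_analysis.
From mathcomp Require Import zify.

Set Implicit Arguments.
Unset Strict Implicit.
Unset Printing Implicit Defensive.

Local Open Scope nat_scope.

(* Only the values [a 1], ..., [a n] matter.  As [m] is a natural number, the
   integers of the interval (m, m + h] are natural numbers. *)
Definition distinct_multiples (n m h : nat) : Prop :=
  exists a : nat -> nat,
    (forall i, 1 <= i <= n -> m < a i <= m + h /\ i %| a i) /\
    (forall i j, 1 <= i <= n -> 1 <= j <= n -> a i = a j -> i = j).

(* Take for [a i] the multiple of [i] in (m + n (i - 1), m + n i]. *)
Lemma distinct_multiples_sqr (n m : nat) : distinct_multiples n m (n * n).
Proof.
have blockP i : 1 <= i <= n ->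
    m + n * i.-1 < ((m + n * i.-1) %/ i).+1 * i <= m + n * i.-1 + n.
  move=> /andP[i0 lein]; rewrite ltn_ceil //= mulSn addnC.
  by rewrite leq_add // leq_divM.
exists (fun i => ((m + n * i.-1) %/ i).+1 * i); split => [i hi|i j hi hj eq_a].
- split; last exact: dvdn_mull.
  have /andP[lo up] := blockP i hi; apply/andP; split; first by lia.
  by apply: (leq_trans up); rewrite -addnA leq_add2l; nia.
- have := blockP i hi; have := blockP j hj; rewrite eq_a.
  move: (_.+1 * j) => c /andP[lj uj] /andP[li ui].
  have [lt_ij|lt_ji|//] := ltngtP i j; exfalso; nia.
Qed.

Lemma ex_distinct_multiples (n m : nat) :
  exists h, `[< distinct_multiples n m h >].
Proof. by exists (n * n); apply/asboolP/distinct_multiples_sqr. Qed.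

Definition f (n m : nat) : nat := ex_minn (ex_distinct_multiples n m).

Lemma f_le_sqr (n m : nat) : f n m <= n * n.
Proof.
rewrite /f; case: ex_minnP => h _; apply.
exact/asboolP/distinct_multiples_sqr.
Qed.

Definition is_f_value (n k : nat) : Prop := exists2 m, 1 <= m & f n m = k.

Lemma ex_f_value (n : nat) : exists k, `[< is_f_value n k >].
Proof. by exists (f n 1); apply/asboolP; exists 1. Qed.

Lemma f_value_le (n k : nat) : `[< is_f_value n k >] -> k <= n * n.
Proof. by move=> /asboolP[m _ <-]; exact: f_le_sqr. Qed.

(* The maximum of [f n m] over all [m >= 1]. *)
Definition F (n : nat) : nat := ex_maxn (ex_f_value n) (@f_value_le n).

(* Main.v *)
(** Upper bound.  Join [i <= n] to [i * q] for the primes [q] with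
    [T < i * q <= 16 * T], where [T] is of order [n log n].  By Chebyshev every
    [i] has at least [D] neighbours, while a number [u] has at most
    [log u / log (T / n) <= D] prime factors exceeding [T / n].  Hall's theorem
    gives [f n n = O(n log n)].

    Lower bound.  Let [S] be the set of primes in [(n/16, n]].  By the Chinese
    remainder theorem [m] can be chosen with [m = rho p] modulo [p] for all
    [p \in S], [rho] arbitrary; the multiples of [p] near [m] are then the
    [m + (y * p - rho p)] with [y] in a set of [Y] consecutive integers
    (the columns).  If the numbers [y * p - rho p] take fewer than [#|S|] values
    in total, the members of [S] have no distinct multiples.  This is a discrete
    Kakeya compression: write [p] in base [R = 2 W^2], a digit being
    [D = D_b + W * D_t] with [D_b < W], and let [rho p] have the corresponding
    digits [tau * D_b + (tau + e) * W * D_t].  In column [y = tau + e + h] such a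
    digit contributes [(e + h) * D_b + h * W * D_t] to [y * p - rho p], a multiple
    of [gcd(e + h, W)], and this takes at most [R / 2] values once
    [2 (h + 1) <= gcd(e + h, W)].  As the mean of [gcd(z, W)] over [z] modulo [W]
    is at least [a^3 / 8] for [W = 30^a], some [e] has about [a^3 / 16] such [h].
    Choosing [tau] greedily for each digit makes the number of values drop below
    [#|S|] with [Y] as large as any multiple of [log n], since the cost [log R]
    of a digit is only [O(a)]. *)

Require Import Defs.
From HB Require Import structures.
From mathcomp Require Import all_boot all_order all_algebra.
From mathcomp Require Import all_classical all_reals all_analysis.
From mathcomp Require Import fintype finset zify.
Import Order.TTheory GRing.Theory Num.Theory.
Import numFieldNormedType.Exports.

Set Implicit Arguments.
Unset Strict Implicit.
Unset Printing Implicit Defensive.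

Local Open Scope nat_scope.

(** * Hall's theorem *)

(** Induction on [#|A|]. A proper nonempty tight [J] is matched on its own, and [A :\: J] keeps
    Hall's condition once the neighbours of [J] are deleted. Without such a [J], every proper
    nonempty subset has a neighbour to spare, so one element may take any of its neighbours. *)
Lemma hall_on (I T : finType) (t0 : T) (A : {set I}) (N : I -> {set T}) :
  (forall J : {set I}, J \subset A -> #|J| <= #|\bigcup_(i in J) N i|) ->
  exists2 g : I -> T, {in A, forall i, g i \in N i} & {in A &, injective g}.
Proof.
move: {2}#|A| (leqnn #|A|) => k; elim: k A N => [|k IH] A N leAk hall.
  have -> : A = set0 by apply/eqP; rewrite -cards_eq0 -leqn0.
  by exists (fun=> t0) => i; rewrite inE.
have [/existsP[J /and4P[JA J0 JnA tight]]|/existsPn slack] :=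
  boolP [exists J : {set I}, [&& J \subset A, J != set0, J != A
                             & #|\bigcup_(i in J) N i| <= #|J|]].
  have ltJA : #|J| < #|A| by apply: proper_card; rewrite properEneq JnA.
  have [|J' J'J|g1 g1N g1I] := IH J N; first by lia.
    by apply: hall; exact: subset_trans J'J JA.
  have cAJ : #|A :\: J| < #|A|.
    by rewrite cardsDS //; move: J0; rewrite -card_gt0; lia.
  pose NJ := \bigcup_(i in J) N i.
  have [|J' /subsetDP[J'A dJ]|g2 g2N g2I] := IH (A :\: J) (fun i => N i :\: NJ).
  - by lia.
  - have /hall : J :|: J' \subset A by rewrite subUset JA.
    rewrite cardsU disjoint_setI0 1?disjoint_sym // cards0 subn0.
    have : \bigcup_(i in J :|: J') N i \subset
        NJ :|: \bigcup_(i in J') (N i :\: NJ).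
      apply/bigcupsP => i iJ; apply/subsetP => x xN; rewrite inE.
      case: (boolP (x \in NJ)) => //= xNJ; apply/bigcupP; exists i.
        move: iJ; rewrite inE => /orP[iJ|//]; case/negP: xNJ.
        by apply/bigcupP; exists i.
      by rewrite inE xNJ.
    move/subset_leq_card/leq_trans/(_ (leq_card_setU _ _)) => up lo.
    by move: (leq_trans lo up) tight; rewrite -/NJ; lia.
  exists (fun i => if i \in J then g1 i else g2 i) => [i iA|i j iA jA].
    case: ifPn => [/g1N//|iJ]; have := g2N i; rewrite !inE iJ iA => /(_ isT).
    by case/andP.
  case: ifPn => iJ; case: ifPn => jJ; first exact: g1I.
  - move=> e; have := g2N j; rewrite !inE jJ jA -e => /(_ isT)/andP[/negP[]].
    by apply/bigcupP; exists i => //; exact: g1N.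
  - move=> e; have := g2N i; rewrite !inE iJ iA e => /(_ isT)/andP[/negP[]].
    by apply/bigcupP; exists j => //; exact: g1N.
  - by apply: g2I; rewrite inE ?iJ ?jJ.
have [->|[i0 i0A]] := set_0Vmem A; first by exists (fun=> t0) => i; rewrite inE.
have /card_gt0P[u uN] : 0 < #|N i0|.
  by have := hall [set i0]; rewrite sub1set cards1 big_set1; exact.
have cA : #|A :\ i0| <= k by move: leAk; rewrite (cardsD1 i0) i0A.
have [//|J JA|g gN gI] := IH (A :\ i0) (fun i => N i :\ u).
  have [->|J0] := eqVneq J set0; first by rewrite cards0.
  have JsA : J \subset A by apply: subset_trans JA (subsetDl _ _).
  have JnA : J != A.
    by apply: contraTneq i0A => <-; apply/negP => /(subsetP JA); rewrite !inE eqxx.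
  have := slack J; rewrite JsA J0 JnA /= -ltnNge => ltJ.
  have -> : \bigcup_(i in J) (N i :\ u) = (\bigcup_(i in J) N i) :\ u.
    apply/setP => x; apply/bigcupP/idP => [[i iJ]|]; rewrite !inE.
      by case/andP=> -> xN /=; apply/bigcupP; exists i.
    by case/andP=> xu /bigcupP[i iJ xN]; exists i; rewrite // !inE xu.
  move: ltJ; rewrite (cardsD1 u (\bigcup_(i in J) N i)); lia.
exists (fun i => if i == i0 then u else g i) => [i iA|i j iA jA].
  case: eqVneq => [->//|ii0]; have := gN i; rewrite !inE ii0 iA => /(_ isT).
  by case/andP.
have gu l : l \in A -> l != i0 -> g l != u.
  by move=> lA li; have := gN l; rewrite !inE li lA => /(_ isT)/andP[].
case: eqVneq => [->|ii]; case: eqVneq => [->//|jj].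
- by move=> e; have := gu j jA jj; rewrite -e eqxx.
- by move=> e; have := gu i iA ii; rewrite e eqxx.
- by apply: gI; rewrite !inE ?ii ?jj.
Qed.

(** Counting the edges at [J] from both sides gives [D * #|J| <= D * #|NJ|], which is Hall's
    condition. *)
Lemma degree_matching (I T : finType) (t0 : T) (E : I -> T -> bool) (D : nat) :
  0 < D -> (forall i, D <= #|[set u | E i u]|) ->
  (forall u, #|[set i | E i u]| <= D) ->
  exists2 g : I -> T, forall i, E i (g i) & injective g.
Proof.
move=> D0 degl degr.
have [J _|g gE gI] := @hall_on I T t0 setT (fun i => [set u | E i u]).
  rewrite -(leq_pmul2l D0); set NJ := \bigcup_(i in J) _.
  have : D * #|J| <= \sum_(i in J) #|[set u | E i u]|.
    by rewrite mulnC -sum_nat_const leq_sum.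
  move/leq_trans; apply; rewrite mulnC -sum_nat_const.
  under eq_bigr => i iJ.
    rewrite -sum1_card big_mkcond /=.
    under eq_bigr do rewrite inE.
    over.
  rewrite exchange_big /= (bigID (mem NJ)) /= [X in _ + X]big1 ?addn0 => [|u uN].
    apply: leq_sum => u _; apply: leq_trans (degr u); rewrite -sum1_card.
    rewrite [leqRHS]big_mkcond /= [leqLHS]big_mkcond /=; apply: leq_sum => i _.
    by rewrite inE; case: ifP.
  rewrite big1 // => i iJ; case: ifP => // iu; case/negP: uN.
  by apply/bigcupP; exists i; rewrite ?inE.
exists g => [i|i j]; first by have := gE i (in_setT _); rewrite inE.
by apply: gI.
Qed.

(** * Primes *)

Lemma coprime_prod_primes (p : nat) (s : seq nat) :
  prime p -> all prime s -> p \notin s -> coprime p (\prod_(q <- s) q).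
Proof.
move=> pp sp ps; rewrite big_seq; elim/big_ind: _ => [|m n cm cn|q qs].
- exact: coprimen1.
- by rewrite coprimeMr cm.
- rewrite prime_coprime // dvdn_prime2 //; last exact: (allP sp).
  by apply: contraNneq ps => ->.
Qed.

Lemma prod_primes_dvd (s : seq nat) (N : nat) :
  uniq s -> all prime s -> {in s, forall p, p %| N} -> \prod_(p <- s) p %| N.
Proof.
elim: s => [|p s IH] /=; first by rewrite big_nil dvd1n.
move=> /andP[ps us] /andP[pp sp] sN.
rewrite big_cons Gauss_dvd ?coprime_prod_primes //.
by rewrite sN ?mem_head // IH // => q qs; apply: sN; rewrite inE qs orbT.
Qed.

Lemma chinese_primes (s : seq nat) (r : nat -> nat) : uniq s -> all prime s ->
  exists m, {in s, forall p, m = r p %[mod p]}.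
Proof.
elim: s => [|p s IH] /=; first by exists 0.
move=> /andP[ps us] /andP[pp sp]; have [m mr] := IH us sp.
have cp := coprime_prod_primes pp sp ps.
exists (chinese p (\prod_(q <- s) q) (r p) m) => q; rewrite inE => /predU1P[->|qs].
  exact: chinese_modl.
rewrite -(mr q qs); have qP : q %| \prod_(q <- s) q by rewrite (big_rem q) //= dvdn_mulr.
by rewrite -(modn_dvdm _ qP) chinese_modr // modn_dvdm.
Qed.

Lemma leq_prod_sub (s t : seq nat) (F : nat -> nat) :
  uniq s -> uniq t -> {subset s <= t} -> {in t, forall x, 0 < F x} ->
  \prod_(x <- s) F x <= \prod_(x <- t) F x.
Proof.
move=> us ut st F0.
have ps : perm_eq s [seq x <- t | x \in s].
  apply: uniq_perm => //; first exact: filter_uniq.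
  by move=> x; rewrite mem_filter; case: (boolP (x \in s)) => //= /st ->.
rewrite (perm_big _ ps) /= big_filter [leqRHS](bigID (mem s)) /=.
by rewrite leq_pmulr // big_seq_cond prodn_cond_gt0 // => x /andP[/F0].
Qed.

Lemma dvdn_fact_ltF (p k : nat) : prime p -> k < p -> (p %| k`!) = false.
Proof.
move=> pp; elim: k => [|k IH] kp; first by rewrite fact0 Euclid_dvd1.
by rewrite factS Euclid_dvdM // IH ?(ltnW kp) // orbF gtnNdvd.
Qed.

(** The equal coefficients at [m] and [m.+1] both occur in the expansion of (1 + 1)^(2m+1). *)
Lemma central_bin_odd_le (m : nat) : 'C(m.*2.+1, m) <= 4 ^ m.
Proof.
rewrite -(leq_pmul2l (isT : 0 < 2)) -[4]/(2 ^ 2) -expnM -expnS mul2n -mul2n.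
have -> : 2 * 'C(m.*2.+1, m) = 'C(m.*2.+1, m) + 'C(m.*2.+1, m.+1).
  rewrite -[in X in _ + X]bin_sub; last by lia.
  by rewrite (_ : m.*2.+1 - m.+1 = m); lia.
rewrite [_ ^ _.+1](expnDn 1 1) (bigD1 (inord m)) //= (bigD1 (inord m.+1)) /=.
  rewrite !inordK; try lia.
  by rewrite !exp1n !muln1 mul2n addnA leq_addr.
by apply/eqP => /(congr1 val) /=; rewrite !inordK; lia.
Qed.

Lemma primorial_le (n : nat) : \prod_(1 <= p < n.+1 | prime p) p <= 4 ^ n.
Proof.
elim/ltn_ind: n => -[|n] IH; first by rewrite big_geq.
case: (boolP (prime n.+1)) => pn; last first.
  rewrite big_mkcond big_nat_recr //= -big_mkcond /= (negPf pn) muln1.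
  by apply: leq_trans (IH n _) _ => //; rewrite leq_exp2l.
case: (even_prime pn) => [[->]|odd_n].
  by rewrite unlock.
have {odd_n} [m def_n] : exists m, n = m.*2.
  by exists n./2; move: odd_n => /= ; lia.
have m0 : 0 < m by move: pn; rewrite def_n; case: (m).
(* The primes up to m + 1 fall under the induction hypothesis; those in (m + 1, 2m + 1] all divide
   the binomial coefficient of 2m + 1 over m. *)
rewrite def_n (@big_cat_nat _ _ _ m.+2) //=; try lia.
apply: (@leq_trans (4 ^ m.+1 * 4 ^ m)); last by rewrite -expnD leq_exp2l //; lia.
apply: leq_mul; first by apply: IH; lia.
apply: leq_trans (central_bin_odd_le m); apply: dvdn_leq.
  by rewrite bin_gt0; lia.
rewrite -big_filter; apply: prod_primes_dvd.
- exact/filter_uniq/iota_uniq.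
- exact: filter_all.
move=> p; rewrite mem_filter mem_index_iota => /and3P[pp mp pm].
have : p %| (m.*2.+1)`! by apply: dvdn_fact; lia.
rewrite -(@bin_fact _ m); last by lia.
rewrite !Euclid_dvdM //.
by rewrite !dvdn_fact_ltF ?orbF //; lia.
Qed.

(** By Legendre's formula the exponent is the sum over k of floor(2n / p^k) - 2 floor(n / p^k); each
    term is at most 1 and vanishes once p^k > 2n. *)
Lemma pfactor_central_bin_le (p n : nat) :
  prime p -> 0 < n -> p ^ logn p 'C(n.*2, n) <= n.*2.
Proof.
move=> pp n0; set v := logn _ _.
suff : v <= trunc_log p n.*2.
  move=> vt; apply: leq_trans (trunc_logP (prime_gt1 pp) _); last by lia.
  by rewrite leq_exp2l // prime_gt1.
have := congr1 (logn p) (@bin_fact n.*2 n _); rewrite (_ : n.*2 - n = n); last by lia.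
rewrite !lognM ?muln_gt0 ?fact_gt0 ?bin_gt0 ?logn_fact //; try lia.
rewrite -/v => /(_ ltac:(lia)).
set S := \sum_(1 <= k < n.+1) _.
have -> : S = \sum_(1 <= k < n.*2.+1) n %/ p ^ k.
  rewrite (@big_cat_nat _ _ _ n.+1 _ n.*2.+1) //=; last by lia.
  rewrite [X in _ + X]big_nat [X in _ + X]big1 ?addn0 // => k /andP[nk _].
  by rewrite divn_small //; apply: ltn_trans nk (ltn_expl _ (prime_gt1 pp)).
move=> sumE.
have : \sum_(1 <= k < n.*2.+1) n.*2 %/ p ^ k <=
    \sum_(1 <= k < n.*2.+1) ((k <= trunc_log p n.*2) + (n %/ p ^ k + n %/ p ^ k)).
  rewrite big_nat [leqRHS]big_nat; apply: leq_sum => k /andP[k0 _].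
  have pk0 : 0 < p ^ k by rewrite expn_gt0 prime_gt0.
  have tE : (k <= trunc_log p n.*2) = (p ^ k <= n.*2).
    apply/idP/idP => [kt|]; last by apply: trunc_log_max; apply: prime_gt1.
    apply: leq_trans (trunc_logP (prime_gt1 pp) _); last by lia.
    by rewrite leq_exp2l // prime_gt1.
  rewrite tE; case: (leqP (p ^ k) n.*2) => pkn; last by rewrite divn_small.
  rewrite {1}(divn_eq n (p ^ k)); have := ltn_pmod n pk0.
  set r := n %% _; set d := n %/ _; rewrite doubleD -mul2n mulnA divnMDl // => rp.
  have : r.*2 %/ p ^ k < 2 by rewrite ltn_divLR //; lia.
  by lia.
rewrite !big_split /= -sumE.
suff : \sum_(1 <= k < n.*2.+1) (k <= trunc_log p n.*2) <= trunc_log p n.*2 by lia.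
rewrite -big_mkcond /= sum1_count.
rewrite -[leqRHS](size_iota 1) -size_filter; apply: uniq_leq_size.
  exact/filter_uniq/iota_uniq.
by move=> k; rewrite mem_filter mem_index_iota mem_iota; lia.
Qed.

Lemma exp2_le_central_bin (n : nat) : 2 ^ n <= 'C(n.*2, n).
Proof.
elim: n => [|n IH] //; rewrite doubleS expnS.
apply: leq_trans (_ : 2 * 'C(n.*2, n) <= _); first by rewrite leq_pmul2l.
have := mul_bin_diag n.*2.+2 n => /= diag.
have := leq_bin2l n (leqnSn n.*2); nia.
Qed.

Lemma sq_le_exp2 (l : nat) : 14 <= l -> 64 * l.+1 ^ 2 <= 2 ^ l.
Proof.
move=> l14; rewrite -(subnK l14); elim: (l - 14) => [//|k IH].
rewrite addSn (expnS 2); apply: leq_trans (_ : 2 * (64 * (k + 14).+1 ^ 2) <= _).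
  by rewrite -!mulnn; nia.
by rewrite leq_mul2l.
Qed.

Lemma ex_sqrt (n : nat) : exists s, s ^ 2 <= n < s.+1 ^ 2.
Proof.
elim: n => [|n [s /andP[lo up]]]; first by exists 0.
have [lt|ge] := ltnP n.+1 (s.+1 ^ 2); first by exists s; lia.
by exists s.+1; rewrite ge /=; move: up; rewrite -!mulnn; nia.
Qed.

(** Factor the central binomial coefficient of X = 16x, which is at least 2^(8x). The primes up to x
    contribute 4^x through the primorial; the at most [s] primes with p^2 <= X and the [c] primes
    above x contribute at most X each. Hence 8x <= 2x + l (s + c), and l s <= 2x. *)
Lemma chebyshev_interval (x : nat) : 2 ^ 10 <= x ->
  4 * x <= (trunc_log 2 (16 * x)).+1 *
           count prime (index_iota x.+1 (16 * x).+1).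
Proof.
move=> x10; set X := 16 * x; set l := (trunc_log 2 X).+1; set c := count _ _.
have X0 : 0 < X by lia.
have Xl : X <= 2 ^ l by apply/ltnW/trunc_log_ltn.
have [s /andP[sX Xs]] := ex_sqrt X.
have lsX : l * s <= 2 * x.
  have : 64 * l ^ 2 <= X.
    apply: leq_trans (trunc_logP (isT : 1 < 2) X0); apply: sq_le_exp2.
    by apply: trunc_log_max; rewrite // -[2 ^ 14]/(2 ^ (4 + 10)) expnD /X; lia.
  by move: sX; rewrite -!mulnn /X; nia.
have Bx : X = (8 * x).*2 by rewrite /X -mul2n mulnA.
set B := 'C((8 * x).*2, 8 * x).
have B0 : 0 < B by rewrite bin_gt0; lia.
pose P := [seq p <- index_iota 1 X.+1 | prime p].
(* [F p] dominates the [p]-part of [B], because a prime with p^2 > X divides [B] at most once. *)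
pose F p := (if p <= x then p else 1) *
            ((if p ^ 2 <= X then X else 1) * (if x < p then X else 1)).
have BP : B <= \prod_(p <- P) F p.
  rewrite [leqLHS](prod_prime_decomp B0) prime_decompE big_map /=.
  apply: leq_trans (_ : \prod_(p <- primes B) F p <= _); last first.
    apply: leq_prod_sub; rewrite ?primes_uniq ?filter_uniq ?iota_uniq //.
      move=> p; rewrite mem_primes mem_filter mem_index_iota => /and3P[pp _ pB].
      rewrite pp prime_gt0 //= ltnS leqNgt; apply/negP => Xp.
      have : p %| ((8 * x).*2)`!.
        by apply: dvdn_trans pB _; rewrite -(@bin_fact _ (8 * x)) ?dvdn_mulr //; lia.
      by rewrite dvdn_fact_ltF // -Bx.
    move=> p; rewrite mem_filter => /andP[/prime_gt0 p0 _].
    by rewrite /F !muln_gt0; do !case: ifP => _; rewrite ?X0 ?p0.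
  rewrite big_seq [leqRHS]big_seq; apply: leq_prod => p.
  rewrite mem_primes => /and3P[pp _ pB].
  have pvX : p ^ logn p B <= X by rewrite Bx; apply: pfactor_central_bin_le; lia.
  have p0 := prime_gt0 pp.
  rewrite /F; case: (leqP p x) => px; rewrite ?muln1 ?mul1n; last first.
    by apply: leq_trans pvX _; rewrite leq_pmull //; case: ifP.
  case: (leqP (p ^ 2) X) => p2; first by apply: leq_trans pvX _; rewrite leq_pmull.
  rewrite muln1 -[leqRHS]expn1 leq_exp2l ?prime_gt1 // -ltnS.
  by rewrite -(@ltn_exp2l p) ?prime_gt1 //; apply: leq_ltn_trans pvX _.
move: BP; rewrite !big_split /=.
have H1 : \prod_(p <- P) (if p <= x then p else 1) <= 2 ^ (2 * x).
  rewrite expnM; apply: leq_trans (primorial_le x).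
  rewrite -big_mkcond -big_filter -[leqRHS]big_filter /=.
  apply: leq_prod_sub; rewrite ?filter_uniq ?iota_uniq // => p.
    by rewrite !mem_filter !mem_index_iota; lia.
  by rewrite mem_filter => /andP[/prime_gt0].
have prodX (Q : pred nat) : \prod_(p <- P) (if Q p then X else 1) = X ^ count Q P.
  by rewrite -big_mkcond big_const_seq iter_muln_1.
have H2 : count (fun p => p ^ 2 <= X) P <= s.
  rewrite -size_filter -[leqRHS](size_iota 1); apply: uniq_leq_size.
    by rewrite !filter_uniq ?iota_uniq.
  move=> p; rewrite !mem_filter mem_index_iota mem_iota => /and3P[pX _ /andP[-> _]].
  by rewrite add1n -(@ltn_exp2r _ _ 2) //; apply: leq_ltn_trans pX Xs.
have H3 : count (fun p => x < p) P <= c.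
  rewrite /c -!size_filter; apply: uniq_leq_size.
    by rewrite !filter_uniq ?iota_uniq.
  by move=> p; rewrite !mem_filter !mem_index_iota; lia.
rewrite !prodX -expnD => Bup.
suff : 2 ^ (8 * x) <= 2 ^ (2 * x + l * (s + c)).
  by rewrite leq_exp2l //; lia.
apply: leq_trans (exp2_le_central_bin _) _; apply: leq_trans Bup _.
rewrite [leqRHS]expnD leq_mul // expnM.
apply: leq_trans (_ : X ^ (s + c) <= _); last by case: (s + c) => // k; rewrite leq_exp2r.
by rewrite leq_pexp2l // leq_add.
Qed.

(** * The diagonal *)

Lemma linear_le_exp2 (b j : nat) : (b + 5 + j) <= (b + 5) * 2 ^ j.
Proof. by elim: j => [|j IH]; rewrite ?muln1 ?addn0 // expnS; nia. Qed.

Lemma f_diag_le : exists N : nat, forall n, N <= n ->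
  f n n <= 128 * n * trunc_log 2 n.
Proof.
exists (2 ^ (2 ^ 10)) => n nN; set lg := trunc_log 2 n.
have lg10 : 2 ^ 10 <= lg by apply: trunc_log_max.
have lg0 : 0 < lg by lia.
have n0 : 0 < n by apply: leq_trans nN; rewrite expn_gt0.
set b := (trunc_log 2 (4 * lg)).+1.
have b10 : 10 <= b by rewrite ltnW // ltnS; apply: trunc_log_max => //; lia.
have lgb : 4 * lg < 2 ^ b by apply: trunc_log_ltn.
have blg : 2 ^ b <= 8 * lg.
  have : 2 ^ trunc_log 2 (4 * lg) <= 4 * lg by apply: trunc_logP; lia.
  by rewrite expnS; lia.
pose T := 2 ^ b * n.
(* As 16 T < 2^(lg + b + 5), [D] is the most factors of size at least 2^b that a vertex [u] can
   have. The bound 2^b <= 8 lg turns 16 T into 128 n lg. *)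
pose D := (lg + b + 4) %/ b.
have D0 : 0 < D by rewrite divn_gt0; lia.
have Db : D * b <= lg + b + 4 by apply: leq_divM.
have b4 : b + 10 <= 2 ^ b
  by rewrite -(subnK b10) expnD; have := ltn_expl (b - 10) (isT : 1 < 2); lia.
pose E (i : 'I_n) (u : 'I_(16 * T).+1) :=
  [&& T < u, i.+1 %| u & prime (u %/ i.+1)].
have T0 : 0 < T by rewrite muln_gt0 expn_gt0.
have [i|u|g gE gI] := @degree_matching _ _ ord0 E D D0.
- pose x := T %/ i.+1.
  have xb : 2 ^ b <= x by rewrite leq_divRL // leq_mul2l ltn_ord orbT.
  have x10 : 2 ^ 10 <= x by apply: leq_trans xb; rewrite leq_exp2l.
  have := chebyshev_interval x10; set l := (trunc_log 2 (16 * x)).+1.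
  set c := count _ _ => lc.
  have cE : c <= #|[set u | E i u]|.
    rewrite /c -size_filter cardE.
    rewrite -(size_map (fun q => inord (i.+1 * q) : 'I_(16 * T).+1)).
    have inP q : q \in [seq q <- index_iota x.+1 (16 * x).+1 | prime q] ->
        [/\ prime q, T < i.+1 * q & i.+1 * q <= 16 * T].
      rewrite mem_filter mem_index_iota => /andP[pq /andP[xq qx]]; split=> //.
        by move: xq; rewrite ltn_divLR // mulnC.
      apply: leq_trans (_ : i.+1 * (16 * x) <= _); first by rewrite leq_mul2l.
      by rewrite mulnCA leq_mul2l /= mulnC leq_divM.
    apply: uniq_leq_size.
      rewrite map_inj_in_uniq ?filter_uniq ?iota_uniq // => q r /inP[_ _ q1] /inP[_ _ r1].
      by move/(congr1 val); rewrite /= !inordK // => /eqP; rewrite eqn_mul2l => /eqP.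
    move=> _ /mapP[q /inP[pq qT q1] ->]; rewrite mem_enum inE /E inordK //.
    by rewrite qT dvdn_mulr // mulKn.
  apply: leq_trans cE.
  have l5 : b + 5 <= l.
    by rewrite addnS ltnS; apply: trunc_log_max; rewrite // addnC expnD leq_mul2l.
  have lx : 2 ^ l.-1 <= 16 * x by apply: trunc_logP => //; lia.
  (* As 16x >= 2^(l-1), the bound 4x / l on the number of primes is weakest at the least possible
     [l], namely b + 5. *)
  have := linear_le_exp2 b (l - (b + 5)); rewrite subnKC // => lj.
  have le : 2 ^ l.-1 = 16 * (2 ^ b * 2 ^ (l - (b + 5))).
    by rewrite -expnD -[16]/(2 ^ 4) -expnD; congr (2 ^ _); lia.
  rewrite -(@leq_pmul2l l) //; apply: leq_trans lc.
  apply: (@leq_trans (4 * (2 ^ b * 2 ^ (l - (b + 5))))); last by lia.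
  apply: leq_trans (leq_mul lj (leqnn D)) _.
  rewrite mulnAC [leqRHS]mulnA leq_mul2r; apply/orP; right.
  have : (b + 5) * D <= 2 * (D * b).
    by rewrite mulnC mulnCA leq_mul2l; lia.
  by move: lgb Db b4; move: (2 ^ b) => B; lia.
(* Distinct neighbours of [u] yield distinct primes, all at least 2^b, whose product divides [u]. *)
- set s := enum [set i | E i u].
  have sE i : i \in s -> E i u by rewrite mem_enum inE.
  pose P := [seq u %/ i.+1 | i : 'I_n <- s].
  have PE p : p \in P -> [/\ prime p, p %| u & 2 ^ b <= p].
    case/mapP => i /sE/and3P[Tu iu pu] ->; split => //.
      by rewrite -{2}(divnK iu) dvdn_mulr.
    rewrite leq_divRL //; apply/ltnW/(leq_ltn_trans _ Tu).
    by rewrite leq_mul2l ltn_ord orbT.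
  have [->|sn] := eqVneq #|[set i | E i u]| 0; first by [].
  have u0 : 0 < u.
    by move: sn; rewrite -lt0n => /card_gt0P[i]; rewrite inE => /andP[/ltnW]; lia.
  have uP : uniq P.
    rewrite map_inj_in_uniq ?enum_uniq // => i j /sE/and3P[_ iu pi] /sE/and3P[_ ju pj] e.
    apply/val_inj/succn_inj/eqP; rewrite -(eqn_pmul2l (prime_gt0 pi)) /=.
    by rewrite {2}e !divnK.
  have : 2 ^ (b * size P) <= u.
    rewrite expnM; apply: leq_trans (dvdn_leq u0 _); last first.
      by apply: prod_primes_dvd uP _ _ => [|p /PE[]//]; apply/allP => p /PE[].
    rewrite -(iter_muln_1 _ (size P)) -(count_predT P) -big_const_seq.
    by rewrite big_seq [leqRHS]big_seq; apply: leq_prod => p /PE[].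
  rewrite size_map -cardE leq_divRL; last by lia.
  move=> bu; rewrite -ltnS -(@ltn_exp2l 2) // mulnC.
  apply: leq_ltn_trans bu (leq_ltn_trans (_ : _ <= 16 * T) _).
    by rewrite -ltnS.
  rewrite (_ : (lg + b + 4).+1 = 4 + b + lg.+1); last by lia.
  rewrite /T -[16]/(2 ^ 4) mulnA -expnD [ltnRHS]expnD ltn_pmul2l ?expn_gt0 //.
  exact: trunc_log_ltn.
rewrite /f; case: ex_minnP => h _; apply; apply/asboolP.
have nE : n.-1.+1 = n by rewrite prednK.
pose o i := cast_ord nE (inord i.-1).
have oE i : 1 <= i <= n -> (o i).+1 = i by move=> ?; rewrite /= inordK; lia.
exists (fun i => nat_of_ord (g (o i))); split => [i hi|i j hi hj].
  have /and3P[Tg] := gE (o i); rewrite oE // => ig _; split=> //.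
  have gT : g (o i) <= 16 * T by rewrite -ltnS.
  have nT : n <= T by rewrite leq_pmull // expn_gt0.
  rewrite (leq_ltn_trans nT Tg) /=; apply: leq_trans gT _.
  apply: leq_trans (leq_addl _ _); rewrite /T; nia.
by move=> /val_inj/gI oo; rewrite -(oE i hi) oo oE.
Qed.

(** * Mean value of the gcd *)

Lemma sum_periodic_shift (M h : nat) (G : nat -> nat) :
  (forall z, G (z + M) = G z) -> \sum_(z < M) G (h + z) = \sum_(z < M) G z.
Proof.
move=> GM; elim: h => [//|h <-]; case: M GM => [|M] GM; first by rewrite !big_ord0.
rewrite big_ord_recr big_ord_recl /= addn0 addnC -(GM h) addSnnS; congr (_ + _).
by apply: eq_bigr => z _; rewrite addSnnS.
Qed.

Lemma sum_periodic_mul (q M : nat) (G : nat -> nat) :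
  (forall z, G (z + M) = G z) -> \sum_(z < q * M) G z = q * \sum_(z < M) G z.
Proof.
move=> GM; elim: q => [|q IH]; first by rewrite big_ord0.
rewrite mulSn addnC big_split_ord /= IH.
by rewrite (sum_periodic_shift (q * M) GM) mulSn addnC.
Qed.

Lemma sum_multiples (Q M : nat) (G : nat -> nat) : 0 < Q ->
  \sum_(t < M) G (Q * t) <= \sum_(z < Q * M | Q %| z) G z.
Proof.
move=> Q0; rewrite big_mkcond; elim: M => [|M IH]; first by rewrite big_ord0.
rewrite big_ord_recr mulnSr big_split_ord /=.
apply: leq_add IH _; rewrite (bigD1 (Ordinal Q0)) //= addn0 ?leq_addr //.
exact: dvdn_mulr.
Qed.

Lemma gcdn_period (d M z : nat) : d %| M -> gcdn (z + M) d = gcdn z d.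
Proof. by move=> /eqP dM; rewrite -gcdn_modl -modnDmr dM addn0 gcdn_modl. Qed.

(** Pillai's arithmetical function; the term z = 0 contributes W. *)
Definition gcd_sum (W : nat) : nat := \sum_(z < W) gcdn z W.

(** From a to a + 1, periodicity multiplies [G] by q, and in addition each multiple z = q^(a+1) t
    gains q^(a+1) - q^a >= q^(a+1) / 2 in its first factor; by coprimality its second factor is
    gcd(t, W). *)
Lemma gcd_sum_pfactor (q a W : nat) : 1 < q -> coprime q W ->
  q ^ a * (a + 2) * gcd_sum W <= 2 * gcd_sum (q ^ a * W).
Proof.
move=> q1 cqW; have q0 : 0 < q by lia.
pose G a := \sum_(z < q ^ a * W) gcdn z (q ^ a) * gcdn z W.
have GE : G a <= gcd_sum (q ^ a * W).
  apply: leq_sum => z _; have [->|z0] := posnP z.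
    by rewrite !gcd0n.
  rewrite dvdn_leq ?gcdn_gt0 ?z0 // dvdn_gcd dvdn_mul ?dvdn_gcdr // andbT.
  rewrite Gauss_dvd ?dvdn_gcdl //.
  apply: coprime_dvdl (dvdn_gcdr _ _) _; apply: coprime_dvdr (dvdn_gcdr _ _) _.
  exact: coprimeXl.
apply: leq_trans (_ : 2 * G a <= _); last by rewrite leq_mul2l.
elim: a {GE} => [|a IH].
  rewrite expn0 mul1n leq_mul2l /= /G /gcd_sum expn0 mul1n.
  by apply: leq_sum => z _; rewrite gcdn1 mul1n.
have qa0 : 0 < q ^ a by rewrite expn_gt0 q0.
have step : q * G a + (q ^ a.+1 - q ^ a) * gcd_sum W <= G a.+1.
  rewrite /G -(@sum_periodic_mul q _ (fun z => gcdn z (q ^ a) * gcdn z W)) => [|z]; last first.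
    by congr (_ * _); apply: gcdn_period; [exact: dvdn_mulr|exact: dvdn_mull].
  have -> : (q ^ a.+1 - q ^ a) * gcd_sum W =
      \sum_(t < W) (q ^ a.+1 - q ^ a) * gcdn (q ^ a.+1 * t) W.
    rewrite big_distrr; apply: eq_bigr => t _; congr (_ * _).
    by rewrite gcdnC [RHS]gcdnC Gauss_gcdr // coprime_sym coprimeXl.
  apply: leq_trans (leq_add (leqnn _)
    (sum_multiples W (fun z => (q ^ a.+1 - q ^ a) * gcdn z W) _)) _.
    by rewrite expn_gt0 q0.
  rewrite mulnA -expnS [X in _ + X]big_mkcond -big_split /=; apply: leq_sum => z _.
  case: ifP => [qz|qz]; last first.
    have z0 : 0 < z by case: posnP qz => // ->; rewrite dvdn0.
    rewrite addn0 leq_mul2r dvdn_leq ?orbT ?gcdn_gt0 ?z0 //.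
    by rewrite dvdn_gcd dvdn_gcdl (dvdn_trans (dvdn_gcdr _ _)) // dvdn_exp2l.
  rewrite (gcdn_idPr qz) (gcdn_idPr _); last first.
    by apply: dvdn_trans qz; rewrite dvdn_exp2l.
  by rewrite -mulnDl subnKC // leq_exp2l.
rewrite expnS in step *; nia.
Qed.

(** Three primes make the mean cubic in [a]. In [F_ge] the digit length and the number [t] of
    halvings together cost only order a^2. *)
Lemma gcd_sum_30 (a : nat) (W := 2 ^ a * (3 ^ a * 5 ^ a)) :
  W * (a + 2) ^ 3 <= 8 * gcd_sum W.
Proof.
have c5 : coprime 5 1 by [].
have c3 : coprime 3 (5 ^ a) by rewrite coprimeXr.
have c2 : coprime 2 (3 ^ a * 5 ^ a) by rewrite coprimeMr !coprimeXr.
have := gcd_sum_pfactor a (isT : 1 < 5) c5.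
have := gcd_sum_pfactor a (isT : 1 < 3) c3.
have := gcd_sum_pfactor a (isT : 1 < 2) c2.
have -> : gcd_sum 1 = 1 by rewrite /gcd_sum big_ord_recl big_ord0.
rewrite !muln1 -/W; set g3 := gcd_sum (3 ^ a * _); set g5 := gcd_sum (5 ^ a).
rewrite /W => h2 h3 h5.
move: (2 ^ a) (3 ^ a) (5 ^ a) (gcd_sum _) (a + 2) g3 g5 h2 h3 h5 => x y z g b g3 g5.
move=> h2 h3 h5; rewrite -/(b ^ 3) !expnS expn0 muln1.
have -> : x * (y * z) * (b * (b * b)) = x * b * (y * b * (z * b)) by lia.
apply: leq_trans (_ : x * b * (y * b * (2 * g5)) <= _).
  by rewrite !leq_mul2l h5 !orbT.
rewrite (_ : x * b * (y * b * (2 * g5)) = 2 * (x * b * (y * b * g5))); last by lia.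
apply: leq_trans (_ : 2 * (x * b * (2 * g3)) <= _).
  by rewrite leq_mul2l /= leq_mul2l h3 orbT.
by rewrite (_ : 2 * (x * b * (2 * g3)) = 4 * (x * b * g3)); lia.
Qed.

Lemma ex_many_close_divisors (a : nat) (W := 2 ^ a * (3 ^ a * 5 ^ a)) :
  exists2 e, e < W &
    a ^ 3 <= 16 * #|[set h : 'I_W | 2 * h.+1 <= gcdn (e + h) W]|.
Proof.
have W0 : 0 < W by rewrite !muln_gt0 !expn_gt0.
pose H e := #|[set h : 'I_W | 2 * h.+1 <= gcdn (e + h) W]|.
have [/existsP[e He]|/existsPn noe] := boolP [exists e : 'I_W, a ^ 3 <= 16 * H e].
  by exists e.
(* For fixed [h], e + h runs over all residues modulo W, so averaging over [e] averages half the
   gcd. *)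
have sumH : \sum_(e < W) H e = \sum_(z < W) (gcdn z W)./2.
  rewrite /H; under eq_bigr do rewrite -sum1dep_card big_mkcond /=.
  rewrite exchange_big /=.
  transitivity (\sum_(h < W) \sum_(z < W) (2 * h.+1 <= gcdn z W)).
    apply: eq_bigr => h _; rewrite -(@sum_periodic_shift W h (fun z => 2 * h.+1 <= gcdn z W)).
      by apply: eq_bigr => e _; rewrite addnC; case: leqP.
    by move=> z; rewrite gcdn_period.
  rewrite exchange_big; apply: eq_bigr => z _.
  have gW : (gcdn z W)./2 <= W by have := dvdn_leq W0 (dvdn_gcdr z W); lia.
  rewrite -[RHS]card_ord -sum1_card (big_ord_widen _ (fun=> 1) gW) [RHS]big_mkcond /=.
  apply: eq_bigr => h _; rewrite (_ : (2 * h.+1 <= _) = (h < (gcdn z W)./2)).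
    by case: ifP.
  by apply/idP/idP; lia.
have := gcd_sum_30 a; rewrite -/W.
have : gcd_sum W <= \sum_(z < W) (2 * (gcdn z W)./2 + 1).
  by apply: leq_sum => z _; lia.
rewrite big_split -big_distrr /= -sumH sum_nat_const card_ord muln1.
have : \sum_(e < W) (16 * H e + 1) <= \sum_(e < W) a ^ 3.
  by apply: leq_sum => e _; have := noe e; rewrite -ltnNge; lia.
rewrite big_split -big_distrr /= !sum_nat_const card_ord muln1.
have : a ^ 3 + 8 <= (a + 2) ^ 3 by rewrite !expnS !expn0; lia.
move: (\sum_(e < W) H e) (gcd_sum W) => S P; nia.
Qed.

(** * Compression of one digit *)

Definition digit_offset (W e tau D : nat) : nat :=
  tau * (D %% W) + (tau + e) * (W * (D %/ W)).

Definition nvalues (F : nat -> int) (n : nat) : nat :=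
  size (undup [seq F d | d <- iota 0 n]).

Lemma nvalues_le (F : nat -> int) (n : nat) (s : seq int) :
  (forall d, d < n -> F d \in s) -> nvalues F n <= size s.
Proof.
move=> Fs; apply: uniq_leq_size (undup_uniq _) _ => v.
by rewrite mem_undup => /mapP[d]; rewrite mem_iota => /Fs ? ->.
Qed.

Lemma nvalues_le_id (F : nat -> int) (n : nat) : nvalues F n <= n.
Proof. by apply: leq_trans (size_undup _) _; rewrite size_map size_iota. Qed.

Lemma nvalues_digit (F G H : nat -> int) (R n : nat) : 0 < R ->
  (forall D d, D < R -> F (D + R * d) = (G D + R%:Z * H d)%R) ->
  nvalues F (R * n) <= nvalues G R * nvalues H n.
Proof.
move=> R0 FE.
rewrite -(size_allpairs (fun v w => (v + R%:Z * w)%R)).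
apply: nvalues_le => d dn.
rewrite (divn_eq d R) addnC mulnC FE ?ltn_pmod //.
apply: (@allpairs_f _ _ _ (fun v w => (v + R%:Z * w)%R)); rewrite mem_undup map_f //.
  by rewrite mem_iota ltn_pmod.
by rewrite mem_iota add0n ltn_divLR // mulnC.
Qed.

Definition column_size (W e tau y : nat) : nat :=
  nvalues (fun D => (y * D)%:Z - (digit_offset W e tau D)%:Z)%R (W * (2 * W)).

Lemma column_size_half (W e h tau : nat) : 0 < W -> e < W -> h < W ->
  2 * h.+1 <= gcdn (e + h) W -> 
  2 * column_size W e tau (tau + e + h) <= W * (2 * W).
Proof.
move=> W0 eW hW; set g := gcdn _ _ => hg.
rewrite mulnCA leq_mul2l /=.
rewrite -[leqRHS](size_iota 0) -[leqRHS](size_map (fun k => Posz (g * k))).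
apply: nvalues_le => D DW; rewrite /digit_offset.
have Dt : D %/ W < 2 * W by rewrite ltn_divLR // mulnC.
have Db := ltn_pmod D W0.
pose v := (e + h) * (D %% W) + h * (W * (D %/ W)).
have -> : Posz ((tau + e + h) * D) =
    Posz (tau * (D %% W) + (tau + e) * (W * (D %/ W)) + v).
  by rewrite {1}(divn_eq D W) /v; congr Posz; lia.
rewrite PoszD [X in (X - _)%R]addrC addrK.
have gv : g %| v.
  by apply: dvdn_add; [exact/dvdn_mulr/dvdn_gcdl|exact/dvdn_mull/dvdn_mulr/dvdn_gcdr].
apply/mapP; exists (v %/ g); last by rewrite mulnC divnK.
have g0 : 0 < g by lia.
rewrite mem_iota /= add0n ltn_divLR //.
(* As e, h < W, the bottom part is below 2 W^2 and the top part is at most h times 2 W^2. Since 2 (h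
   + 1) <= g, at most W^2 multiples of [g] fit. *)
have lt_v : v < h.+1 * (W * (2 * W)).
  have : (e + h) * (D %% W) < 2 * W * W.
    apply: leq_ltn_trans (_ : (e + h) * W < _); first by rewrite leq_mul2l ltnW ?orbT.
    by rewrite ltn_pmul2r //; lia.
  have : h * (W * (D %/ W)) <= h * (W * (2 * W)) by rewrite !leq_mul2l ltnW ?orbT.
  by rewrite /v; lia.
by apply: leq_trans lt_v _; nia.
Qed.

(** * The lower bound for F *)

(* This is [rho].  The digits of [d] are taken least significant first; those
   beyond [size taus] contribute nothing, which keeps [rho p] below [p]. *)
Fixpoint offset (W e : nat) (taus : seq nat) (d : nat) : nat :=
  if taus is tau :: taus' then
    digit_offset W e tau (d %% (W * (2 * W))) +
    W * (2 * W) * offset W e taus' (d %/ (W * (2 * W)))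
  else 0.

(** The factor [n] counts the parts of [d] above its lowest [size taus] digits, which are not
    compressed. *)
Lemma nvalues_offset (W e y n : nat) (taus : seq nat) : 0 < W ->
  nvalues (fun d => (y * d)%:Z - (offset W e taus d)%:Z)%R
    ((W * (2 * W)) ^ size taus * n) <=
  n * \prod_(tau <- taus) column_size W e tau y.
Proof.
move=> W0; have R0 : 0 < W * (2 * W) by lia.
elim: taus => [|tau taus IH] /=.
  by rewrite big_nil muln1 mul1n nvalues_le_id.
rewrite big_cons [leqRHS]mulnCA expnS -mulnA.
apply: leq_trans (leq_mul (leqnn _) IH).
apply: nvalues_digit => // D d DR.
have -> : (D + W * (2 * W) * d) %% (W * (2 * W)) = D.
  by rewrite mulnC addnC modnMDl modn_small.
have -> : (D + W * (2 * W) * d) %/ (W * (2 * W)) = d.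
  by rewrite addnC mulnC divnMDl // divn_small // addn0.
by rewrite !PoszD !PoszM; lia.
Qed.

(** A digit D contributes at most (tau + e) D <= (Y + W) (R - 1), and the geometric sum telescopes.
    The summand [Y + W] stands on the left to avoid truncated subtraction. *)
Lemma offset_le (W e Y d : nat) (taus : seq nat) : 0 < W -> e < W ->
  all (fun tau => tau < Y) taus ->
  offset W e taus d + (Y + W) <= (Y + W) * (W * (2 * W)) ^ size taus.
Proof.
move=> W0 eW; set R := W * (2 * W); have R0 : 0 < R by rewrite /R; lia.
elim: taus d => [|tau taus IH] d /=; first by rewrite muln1.
case/andP=> tY /(IH (d %/ R)) {}IH.
have DR := ltn_pmod d R0.
have : digit_offset W e tau (d %% R) <= (Y + W) * R.-1.
  apply: leq_trans (_ : (tau + e) * (d %% R) <= _); last by apply: leq_mul; lia.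
  rewrite [X in _ <= _ * X](divn_eq _ W) mulnDr [leqRHS]addnC [X in _ + _ * X]mulnC.
  by rewrite leq_add2r leq_mul2r leq_addr orbT.
rewrite -/R expnS; move: IH; move: (offset _ _ _ _) (digit_offset _ _ _ _) (R ^ _) => x z r.
by nia.
Qed.

(* Averaging over [tau]: every column is halved by at least [zeta] of the [Y]
   possible centres. *)
Lemma ex_good_centre (W e Y zeta q : nat) (u : nat -> nat) : 0 < W -> e < W ->
  zeta = #|[set h : 'I_W | 2 * h.+1 <= gcdn (e + h) W]| ->
  0 < Y -> 2 * Y <= q * zeta ->
  exists2 tau, tau < Y &
    q * \sum_(2 * W <= y < Y) u y * column_size W e tau y <=
    q.-1 * (W * (2 * W)) * \sum_(2 * W <= y < Y) u y.
Proof.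
move=> W0 eW zE Y0 Yq; set R := W * (2 * W); set U := \sum_(_ <= y < _) u y.
pose S tau := \sum_(2 * W <= y < Y) u y * column_size W e tau y.
have col y : 2 * W <= y < Y ->
    2 * (\sum_(tau < Y) column_size W e tau y) + zeta * R <= 2 * Y * R.
  move=> hy; rewrite zE.
  pose good (tau : 'I_Y) := 2 * column_size W e tau y <= R.
  have zg : zeta <= #|[set tau | good tau]|.
    (* This centre makes [y] the column tau + e + h. As y >= 2W, the subtractions do not
       truncate. *)
    pose to (h : 'I_W) : 'I_Y := insubd (Ordinal Y0) (y - e - h).
    have toE (h : 'I_W) : to h = y - e - h :> nat.
      by rewrite val_insubd; case: (ltnP (y - e - h) Y) => //; lia.
    rewrite zE -(@card_in_imset _ _ to) => [|h1 h2 _ _ /(congr1 val) /=].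
      apply/subset_leq_card/subsetP => tau /imsetP[h]; rewrite inE => hg ->.
      have := column_size_half (to h) W0 eW (ltn_ord h) hg.
      rewrite (_ : to h + e + h = y) ?inE // toE.
      by have := ltn_ord h; lia.
    rewrite !toE => e12; apply: val_inj => /=.
    by have := ltn_ord h1; have := ltn_ord h2; lia.
  apply: leq_trans (_ : \sum_(tau < Y) (2 * column_size W e tau y + good tau * R) <= _).
    rewrite big_split /= -big_distrr -big_distrl /= leq_add2l leq_mul2r -zE.
    by rewrite -big_mkcond sum1dep_card zg orbT.
  apply: leq_trans (_ : \sum_(tau < Y) 2 * R <= _); last first.
    by rewrite sum_nat_const card_ord; lia.
  apply: leq_sum => tau _; rewrite /good.
  have : column_size W e tau y <= R by apply: nvalues_le_id.
  by case: leqP; lia.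
have [/existsP[tau St]|/existsPn noS] :=
  boolP [exists tau : 'I_Y, q * S tau <= q.-1 * R * U]; first by exists tau.
have q0 : 0 < q by lia.
have lo : \sum_(tau < Y) (q.-1 * R * U + 1) <= \sum_(tau < Y) q * S tau.
  by apply: leq_sum => tau _; rewrite addn1 ltnNge.
have up : 2 * (\sum_(tau < Y) S tau) + zeta * R * U <= 2 * Y * R * U.
  rewrite /S exchange_big /U !big_distrr -big_split /= big_nat [leqRHS]big_nat.
  apply: leq_sum => y /col hy; rewrite -big_distrr /=.
  move: hy; set s := \sum_(_ < _) _; nia.
move: lo; rewrite sum_nat_const card_ord -big_distrr /=.
move: up; set s := \sum_(_ < _) _ => up lo.
have : 2 * (q * s) + q * zeta * (R * U) <= 2 * q * Y * (R * U) by nia.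
have : 2 * Y * (R * U) <= q * zeta * (R * U) by rewrite leq_mul2r Yq orbT.
by move: lo; rewrite -(prednK q0) /=; nia.
Qed.

(** Greedy choice: the product of the column sizes fixed so far is the weight [u] for the next
    digit. *)
Lemma ex_good_centres (W e Y q k : nat) : 0 < W -> e < W -> 0 < Y ->
  2 * Y <= q * #|[set h : 'I_W | 2 * h.+1 <= gcdn (e + h) W]| ->
  exists taus, [/\ size taus = k, all (fun tau => tau < Y) taus &
    q ^ k * \sum_(2 * W <= y < Y) \prod_(tau <- taus) column_size W e tau y <=
    (q.-1 * (W * (2 * W))) ^ k * Y].
Proof.
move=> W0 eW Y0 Yq; elim: k => [|k [taus [sz tY IH]]].
  exists [::]; split=> //; rewrite !expn0 !mul1n.
  by under eq_bigr do rewrite big_nil; rewrite sum_nat_const_nat muln1 leq_subr.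
have [tau ltau Htau] := ex_good_centre (fun y => \prod_(tau <- taus) column_size W e tau y)
  W0 eW erefl Y0 Yq.
exists (tau :: taus); split; rewrite /= ?sz ?ltau //.
under eq_bigr do rewrite big_cons mulnC.
rewrite expnSr expnS -[leqRHS]mulnA -mulnA.
apply: leq_trans (leq_mul (leqnn _) Htau) _.
by rewrite mulnCA leq_mul.
Qed.

Lemma bernoulli_exp (x n : nat) : x ^ n * (x + n) <= x * x.+1 ^ n.
Proof. by elim: n => [|n IH]; rewrite ?expn0 ?mul1n ?muln1 ?addn0 // !expnS; nia. Qed.

(** This is (1 - 1/q)^q <= 1/2: every [q] digits halve the number of values relative to the trivial
    count. *)
Lemma double_exp_le (q : nat) : 1 < q -> 2 * q.-1 ^ q <= q ^ q.
Proof.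
case: q => [//|x] x0 /=; rewrite -(@leq_pmul2l x) //.
by apply: leq_trans (bernoulli_exp x x.+1); nia.
Qed.

(** The last four hypotheses in turn provide good centres, confine the multiples in the window to
    columns below [Y], keep [offset] small against [n], and make the values fewer than the primes in
    (n/16, n]. *)
Lemma F_gt (n h W e Y q t : nat) : 0 < W -> e < W -> 0 < n -> 1 < q ->
  2 * Y <= q * #|[set h : 'I_W | 2 * h.+1 <= gcdn (e + h) W]| ->
  16 * (2 * W * n + h) <= Y.-1 * n ->
  16 * ((Y + W) * (W * (2 * W)) ^ (q * t)) <= n ->
  2 * n * Y < 2 ^ t * count prime (index_iota (n %/ 16).+1 n.+1) ->
  h < F n.
Proof.
move=> W0 eW n0 q1 Yq hY Rn countP; set R := W * (2 * W) in Rn.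
have Y0 : 0 < Y by nia.
have [taus [sz tY St]] := ex_good_centres (q * t) W0 eW Y0 Yq.
set S := \sum_(_ <= y < _) _ in St.
have {}St : 2 ^ t * S <= R ^ (q * t) * Y.
  have qt : 2 ^ t * q.-1 ^ (q * t) <= q ^ (q * t).
    by rewrite 2!expnM -expnMn; case: (t) => // k; rewrite leq_exp2r // double_exp_le.
  have q10 : 0 < q.-1 ^ (q * t) by rewrite expn_gt0; lia.
  rewrite -(leq_pmul2l q10) mulnA [_ * 2 ^ t]mulnC mulnA -expnMn.
  by apply: leq_trans St; rewrite leq_mul2r qt orbT.
pose P := [seq p <- index_iota (n %/ 16).+1 n.+1 | prime p].
have PP p : p \in P -> [/\ prime p, n < 16 * p & p <= n].
  by rewrite mem_filter mem_index_iota => /and3P[-> ]; rewrite ltn_divLR // mulnC ltnS.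
have uP : uniq P by rewrite filter_uniq ?iota_uniq.
have [m mE] := chinese_primes (offset W e taus) uP (filter_all _ _).
have R0 : 0 < R ^ (q * t) by rewrite expn_gt0 /R; lia.
(* Every p <= n is below M R^(qt), which is at most 2n. *)
pose M := n %/ R ^ (q * t) + 1.
pose V y := undup [seq ((y * d)%:Z - (offset W e taus d)%:Z)%R | d <- iota 0 (R ^ (q * t) * M)].
pose X := flatten [seq V y | y <- index_iota (2 * W) Y].
have sX : size X <= M * S.
  rewrite size_flatten /shape -map_comp sumnE big_map /S big_distrr /=.
  by apply: leq_sum => y _; have := nvalues_offset e y M taus W0; rewrite sz.
have XP : 2 ^ t * size X < 2 ^ t * size P.
  rewrite size_filter; apply: leq_ltn_trans countP.
  apply: leq_trans (leq_mul (leqnn _) sX) _.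
  rewrite mulnCA; apply: leq_trans (leq_mul (leqnn _) St) _.
  rewrite mulnA leq_mul2r; apply/orP; right.
  rewrite /M mulnDl mul1n; have := leq_divM n (R ^ (q * t)).
  have : R ^ (q * t) <= n by nia.
  by lia.
have fF m' : 0 < m' -> f n m' <= F n.
  by rewrite /F; case: ex_maxnP => k _ kmax m0; apply: kmax; apply/asboolP; exists m'.
(* The shift by 2Wn puts the multiples of every p <= n into columns y >= 2W, the range of the
   averaging. *)
apply: leq_trans (fF (m + 2 * W * n) _); last by nia.
rewrite ltnNge; apply/negP => fh.
have [a [aP aI]] : distinct_multiples n (m + 2 * W * n) (f n (m + 2 * W * n)).
  by rewrite /f; case: ex_minnP => k /asboolP.
suff : size P <= size X by move: XP; rewrite ltn_mul2l; lia.
rewrite -(size_map (fun p => (a p)%:Z - m%:Z)%R).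
apply: uniq_leq_size.
  rewrite map_inj_in_uniq // => p p' /PP[pp _ pn] /PP[pp' _ pn'] /addIr[].
  by apply: aI; rewrite ?prime_gt0.
move=> _ /mapP[p pP ->]; have [pp np pn] := PP p pP.
have [/andP[lo up] pa] := aP p ltac:(rewrite ?prime_gt0 //).
have dvd_x : p %| a p - m + offset W e taus p.
  rewrite /dvdn -modnDmr -(mE p pP) modnDmr subnK; last by lia.
  exact: pa.
have [y yE] := dvdnP dvd_x.
have := offset_le p W0 eW tY; rewrite sz => sp.
have yW : 2 * W <= y.
  rewrite leqNgt; apply/negP => yW.
  have : 2 * W * n < y * p by rewrite -yE (leq_trans _ (leq_addr _ _)) // ltn_subRL.
  by rewrite ltnNge leq_mul // ltnW.
have yY : y < Y.
  have aph : a p - m <= 2 * W * n + h.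
    by rewrite leq_subLR addnA; apply: leq_trans up _; rewrite leq_add2l.
  have yp : 16 * (y * p) < Y * n.
    rewrite -yE -(prednK Y0); move: hY Rn sp aph Y0.
    rewrite -/R; move: (offset _ _ _ _) (_ * R ^ _) (a p - m) (2 * W * n) => x r z w.
    by rewrite mulSn; clear; lia.
  have : y * (16 * p) < Y * (16 * p).
    by rewrite mulnCA (leq_trans yp) // leq_mul2l ltnW ?orbT.
  by rewrite ltn_pmul2r //; apply: leq_ltn_trans np.
apply/flattenP; exists (V y).
  by apply: (map_f V); rewrite mem_index_iota yW.
rewrite mem_undup; apply/mapP; exists p; last first.
  rewrite -yE PoszD addrK subzn //.
  by apply: leq_trans (ltnW lo); rewrite leq_addr.
rewrite mem_iota /= add0n; apply: leq_ltn_trans pn _.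
by rewrite /M addn1 mulnC ltn_ceil.
Qed.

Lemma leq_count_primes (n : nat) : 2 ^ 14 <= n ->
  n <= 16 * trunc_log 2 n * count prime (index_iota (n %/ 16).+1 n.+1).
Proof.
move=> n15; set x := n %/ 16.
have x10 : 2 ^ 10 <= x.
  by rewrite leq_divRL -1?[16]/(2 ^ 4) -?expnD.
have n32 : 32 <= n by apply: leq_trans n15; rewrite -[32]/(2 ^ 5) leq_exp2l.
clear n15.
have xn : 16 * x <= n by rewrite mulnC leq_divM.
have := chebyshev_interval x10; set c' := count _ _; set c := count _ _ => cheb.
have cc : c' <= c.
  rewrite /c /index_iota (_ : n.+1 - x.+1 = (16 * x).+1 - x.+1 + (n - 16 * x)); last by lia.
  by rewrite iotaD count_cat leq_addr.
have lg1 : 0 < trunc_log 2 n by rewrite trunc_log_gt0 /=; clear -n32; lia.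
have lgx := leq_trunc_log 2 xn.
have nx : n < 16 * x + 16 by have := ltn_ceil n (isT : 0 < 16); rewrite -/x; lia.
have : (trunc_log 2 (16 * x)).+1 * c' <= 2 * trunc_log 2 n * c by apply: leq_mul; lia.
clear x10; lia.
Qed.

Lemma F_ge (B : nat) : exists N, forall n, N <= n -> B * n * trunc_log 2 n < F n.
Proof.
pose C := 33 + 16 * B; pose A0 := 16 * (32 * (32 * C)).
exists (2 ^ (32 ^ A0)) => n nN; set lg := trunc_log 2 n.
have lgA : 32 ^ A0 <= lg by apply: trunc_log_max.
have lg0 : 0 < lg by apply: leq_trans lgA; rewrite expn_gt0.
have n15 : 2 ^ 14 <= n.
  apply: leq_trans nN; rewrite leq_exp2l //; apply: leq_trans (_ : 32 ^ 1 <= _) => //.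
  by rewrite leq_exp2l.
have n0 : 0 < n by apply: leq_trans n15; rewrite expn_gt0.
have lgn : 2 ^ lg <= n by apply: trunc_logP.
(* Base 32 = 2^5 replaces 30: then W = 30^a <= 32^a <= lg, and powers of 32 are powers of two. *)
set a := trunc_log 32 lg.
have aA : A0 <= a by apply: trunc_log_max.
have alg : 32 ^ a <= lg by apply: trunc_logP.
have lga : lg < 32 ^ a.+1 by apply: trunc_log_ltn.
have a5 : a ^ 5 <= lg.
  apply: leq_trans alg; rewrite -[32]/(2 ^ 5) -expnM mulnC expnM leq_exp2r //.
  exact/ltnW/ltn_expl.
have C33 : 33 <= C by rewrite leq_addr.
have {}aA : 16 * (32 * (32 * C)) <= a by [].
have a0 : 0 < a ^ 3 by rewrite expn_gt0; lia.
have [e] := ex_many_close_divisors a; set W := 2 ^ a * (3 ^ a * 5 ^ a) => eW zeta.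
have W0 : 0 < W by lia.
have W32 : W <= 2 ^ (5 * a).
  by rewrite /W -!expnMn expnM; case: (a) => // k; rewrite leq_exp2r.
have Wlg : W <= lg by apply: leq_trans W32 _; rewrite expnM.
(* [Y.-1] is exactly what the window length B n lg demands in [F_gt]. The choice of [q] gives 32 Y
   <= q a^3, where a^3 is at most 16 times the number of good [h]; the summand 2 covers the rounding
   and 1 < q. *)
pose Y := (32 * W + 16 * (B * lg)).+1; pose q := (32 * Y) %/ a ^ 3 + 2.
(* Chosen so that 2^t > 32 C lg^2, using lg < 2^(5 (a + 1)). *)
pose t := 10 * a + 10 + 32 * C.
have YC : Y <= C * lg by rewrite /Y /C; nia.
have qa : q * a ^ 3 <= 32 * Y + 2 * a ^ 3.
  by rewrite /q mulnDl leq_add2r leq_divM.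
have t11 : t <= 11 * a by rewrite /t; lia.
(* The main term, the cost of all digits, is of order C lg / a; the threshold [A0] on [a] makes it
   small against lg. *)
have bound : 16 * (C + 1) + 5 * a.+1 + (10 * a + 1) * (q * t) <= lg.
  have u1 : (10 * a + 1) * (q * t) <= 121 * (q * a ^ 2).
    rewrite mulnCA [leqRHS]mulnCA leq_mul2l; apply/orP; right.
    apply: leq_trans (_ : 11 * a * (11 * a) <= _); last by rewrite -mulnn; lia.
    by apply: leq_mul; lia.
  have u2 : 242 * (q * a ^ 2) <= lg.
    rewrite -(@leq_pmul2l a); last by lia.
    rewrite (_ : a * _ = 242 * (q * a ^ 3)); last by rewrite !expnS; lia.
    apply: leq_trans (_ : 242 * (32 * (C * lg) + 2 * a ^ 3) <= _).
      by rewrite leq_mul2l (leq_trans qa) // leq_add2r leq_mul2l.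
    have : 16 * (32 * (32 * C)) * lg <= a * lg by rewrite leq_mul2r aA orbT.
    have : 16 * (32 * 32) * a ^ 3 <= lg.
      apply: leq_trans a5; rewrite (_ : a ^ 5 = a * a * a ^ 3); last by rewrite !expnS; lia.
      rewrite leq_mul2r; apply/orP; right; apply: leq_mul; lia.
    have : 33 * lg <= C * lg by rewrite leq_mul2r C33 orbT.
    by lia.
  have : 100 * a <= lg.
    apply: leq_trans a5; apply: leq_trans (_ : a ^ 2 <= _); last by rewrite leq_pexp2l; lia.
    by rewrite -mulnn leq_mul2r; lia.
  by lia.
apply: (@F_gt _ _ W e Y q t) => //.
- by rewrite /q addn2.
- rewrite -(@leq_pmul2l 16) //; apply: leq_trans (_ : q * a ^ 3 <= _).
    rewrite /q mulnDl; have := ltn_ceil (32 * Y) a0; lia.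
  by rewrite [leqRHS]mulnCA leq_mul2l zeta orbT.
- by rewrite /Y /=; lia.
- apply: leq_trans lgn; apply: leq_trans (_ : 2 ^ (16 * (C + 1) + 5 * a.+1 + (10 * a + 1) * (q * t)) <= _).
    have -> : (W * (2 * W)) = 2 * W ^ 2 by rewrite -mulnn mulnCA.
    rewrite 2!expnD mulnA; apply: leq_mul.
      apply: leq_trans (_ : 16 * (C + 1) * lg <= _); last first.
        by apply: leq_mul; [exact/ltnW/ltn_expl|rewrite expnM ltnW].
      by rewrite -mulnA leq_mul2l mulnDl mul1n leq_add.
    apply: (@leq_trans ((2 ^ (10 * a + 1)) ^ (q * t))).
      case: (q * t) => // k; rewrite leq_exp2r // addnC (expnS 2) leq_mul2l /=.
      by rewrite (_ : 10 * a = 5 * a * 2) 1?expnM ?leq_exp2r //; lia.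
    by rewrite -expnM.
  by rewrite leq_exp2l.
- set c := count _ _; have := leq_count_primes n15; rewrite -/lg -/c => nc.
  have c0 : 0 < c by case: (c) nc; lia.
  have lg2 : lg <= 2 ^ (5 * a.+1) by rewrite expnM ltnW.
  have Ct : 32 * C * lg ^ 2 < 2 ^ t.
    rewrite /t (_ : _ + _ = 32 * C + (5 * a.+1) * 2); last by lia.
    rewrite expnD (expnM _ (5 * a.+1)); apply: leq_ltn_trans (_ : 32 * C * (2 ^ (5 * a.+1)) ^ 2 < _).
      by rewrite leq_mul2l leq_exp2r // lg2 orbT.
    by rewrite ltn_pmul2r; [exact: ltn_expl|rewrite !expn_gt0].
  apply: leq_ltn_trans (_ : 32 * C * lg ^ 2 * c < _); last by rewrite ltn_pmul2r.
  apply: leq_trans (_ : 2 * (16 * lg * c) * (C * lg) <= _).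
    by apply: leq_mul => //; rewrite leq_mul2l.
  by rewrite -mulnn; lia.
Qed.

(** * Real logarithms and the limit *)

Local Open Scope classical_set_scope.
Local Open Scope ring_scope.

Lemma F_sub_f_ge (B : nat) : exists N, forall n, (N <= n)%N ->
  (f n n + B * n * trunc_log 2 n < F n)%N.
Proof.
(* The extra 128 pays for the bound of [f_diag_le]. *)
have [[N1 fN] [N2 FN]] := (f_diag_le, F_ge (B + 128)).
by exists (maxn N1 N2) => n; rewrite geq_max => /andP[/fN ? /FN ?]; nia.
Qed.

Lemma ln_le_trunc_log (R : realType) (n : nat) : (1 < n)%N ->
  ln n%:R <= 2 * (trunc_log 2 n)%:R :> R.
Proof.
move=> n1; have lg0 : (0 < trunc_log 2 n)%N by rewrite trunc_log_gt0 /=; lia.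
apply: (@le_trans _ _ (trunc_log 2 n).+1%:R); last by rewrite -natrM ler_nat; lia.
rewrite -[leRHS]expRK ler_ln ?posrE ?expR_gt0 ?ltr0n 1?ltnW //.
rewrite -[X in expR X]mulr1 expRM_natl.
apply: (@le_trans _ _ (2 ^+ (trunc_log 2 n).+1)).
  by rewrite -natrX ler_nat ltnW // trunc_log_ltn.
by rewrite lerXn2r ?nnegrE ?expR_ge0 //; have := expR_ge1Dx (1 : R).
Qed.

Lemma ln_ln_ge1 (R : realType) : exists N : nat, forall n : nat, (N <= n)%N ->
  [/\ 0 < n%:R :> R, 0 < ln n%:R :> R & 1 <= ln (ln n%:R) :> R].
Proof.
exists (Num.truncn (expR (expR 1 : R))).+1 => n Nn.
have e1 : expR (expR 1) <= n%:R :> R.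
  by apply: le_trans (ltW (truncnS_gt _)) _; rewrite ler_nat.
have n0 : 0 < n%:R :> R by apply: lt_le_trans e1; exact: expR_gt0.
have e2 : expR 1 <= ln n%:R :> R.
  by rewrite -[leLHS]expRK ler_ln ?posrE ?expR_gt0.
have ln0 : 0 < ln n%:R :> R by apply: lt_le_trans e2; exact: expR_gt0.
by split => //; rewrite -[leLHS]expRK ler_ln ?posrE ?expR_gt0.
Qed.

Theorem corollary1p2 (R : realType) :
  (forall A : R, 0 < A ->
     exists N : nat, forall n : nat, (N <= n)%N ->
       (F n)%:R - (f n n)%:R > A * n%:R * ln n%:R / ln (ln n%:R)) /\
  (fun n : nat => ((F n)%:R - (f n n)%:R) / (n%:R * ln n%:R / ln (ln n%:R)) : R)
    @ \oo --> +oo.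
Proof.
have [N0 lnN] := ln_ln_ge1 R.
have lower (A : R) : 0 < A -> exists N : nat, forall n : nat, (N <= n)%N ->
    (F n)%:R - (f n n)%:R > A * n%:R * ln n%:R / ln (ln n%:R).
  move=> A0; pose B := (Num.truncn (2 * A)).+1.
  have [N1 FN] := F_sub_f_ge B.
  exists (maxn 2 (maxn N0 N1)) => n; rewrite !geq_max => /and3P[n1 /lnN[n0 l0 ll1] /FN FfB].
  have {}FfB : B%:R * n%:R * (trunc_log 2 n)%:R < (F n)%:R - (f n n)%:R :> R.
    by rewrite ltrBrDl -!natrM -natrD ltr_nat.
  apply: le_lt_trans FfB.
  (* The bound holds even without the iterated logarithm: as it is at least 1, dividing by it only
     lowers the target. *)
  apply: (@le_trans _ _ (A * n%:R * ln n%:R)).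
    by rewrite ler_pdivrMr ?(lt_le_trans ltr01) // ler_peMr // !mulr_ge0 // ltW.
  apply: (@le_trans _ _ (A * n%:R * (2 * (trunc_log 2 n)%:R))).
    by rewrite ler_wpM2l ?ln_le_trunc_log // mulr_ge0 // ltW.
  rewrite [leLHS](_ : _ = 2 * A * n%:R * (trunc_log 2 n)%:R); last first.
    by rewrite mulrCA !mulrA.
  by rewrite !ler_wpM2r // ltW // truncnS_gt.
split=> //; apply/cvgryPge => A.
(* Divergence quantifies over all real [A], while [lower] asks for a positive constant. *)
have A0 : 0 < Num.max A 1 by rewrite lt_max ltr01 orbT.
have [N1 FN] := lower _ A0.
exists (maxn N0 N1) => // n /=; rewrite geq_max => /andP[/lnN[n0 l0 ll1] /FN FfA].
apply: (@le_trans _ _ (Num.max A 1)); first by rewrite le_max lexx.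
rewrite ler_pdivlMr; first by rewrite !mulrA ltW.
by rewrite !mulr_gt0 // invr_gt0 (lt_le_trans ltr01).
Qed.
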